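(* Let $G$ be a finite group. Let $S$ be a nonabelian finite simple group such that $\mathrm{Out}(S)=\mathrm{Aut}(S)/\mathrm{Inn}(S)$ is cyclic modulo $p$ for some prime $p$. If exactly one composition factor of $G$ (counted with multiplicity) is isomorphic to $S$, then $\beta(G)$ is not solvable.
   Context: For a prime $p$, a finite group $H$ is called cyclic modulo $p$ (or $p$-hypo-elementary) if $H/O_p(H)$ is cyclic, where $O_p(H)$ is the largest normal $p$-subgroup of $H$. For a finite group $G$ and $N\trianglelefteq G$, define the rational number $m_{G,N}=\frac{1}{|G|}\sum_{X\le G,\ XN=G}|X|\,\mu(X,G)$, where $\mu$ is the Möbius function of the poset of subgroups of $G$. If $N\trianglelefteq G$ is maximal (with respect to inclusion) among normal subgroups with $m_{G,N}\neq 0$, set $\beta(G)=G/N$; this is well defined up to isomorphism. *)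

(* Defs.v *)
From HB Require Import structures.
From mathcomp Require Import all_boot all_order all_algebra all_fingroup all_solvable.
Set Implicit Arguments. Unset Strict Implicit. Unset Printing Implicit Defensive.
Import GRing.Theory Num.Theory.

Local Open Scope group_scope.

Section Defs.
Variable gT : finGroupType.

(* Moebius function mu(X, G) of the poset of subgroups of G, computed with
   fuel: mu(G,G) = 1 and, for X < G, mu(X,G) = - sum_{X < Y <= G} mu(Y,G).
   Chains of subgroups of G have length < #|G|, so fuel #|G|.+1 suffices. *)
Fixpoint mobius_fuel (n : nat) (G X : {set gT}) : int :=
  if X == G then 1%R else
  match n with
  | 0 => 0%R
  | n'.+1 => (- \sum_(Y : {group gT} | (X \proper Y) && (Y \subset G))
                 mobius_fuel n' G Y)%R
  end.

Definition mobius (X G : {set gT}) : int := mobius_fuel #|G|.+1 G X.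

Definition mGN (G N : {set gT}) : rat :=
  ((\sum_(X : {group gT} | (X \subset G) && ((X * N)%g == G))
       (#|X|%:R * (mobius X G)%:~R)) / #|G|%:R)%R.

(* N is maximal among normal subgroups of G with m_{G,N} <> 0;
   beta(G) is then G / N. *)
Definition beta_kernel (G N : {group gT}) : Prop :=
  [/\ N <| G, mGN G N != 0%R &
      forall M : {group gT}, M <| G -> mGN G M != 0%R -> N \subset M -> M = N].

Definition comp_factor_count (sT : finGroupType) (S : {set sT})
    (G : {group gT}) (s : seq {group gT}) : nat :=
  count (fun p : {group gT} * {group gT} => (p.1 / p.2) \isog S) (zip (G :: s) s).

Definition Out (S : {group gT}) := Aut S / (conj_aut S @* S).

End Defs.

Definition cyclic_mod (p : nat) (gT : finGroupType) (H : {set gT}) : bool :=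
  cyclic (H / 'O_p(H)).

(* Main.v *)
(* Suppose m_{G,N} is nonzero and G / N is solvable. The unique composition factor
   S of G then lies below N and, being unique, it is a chief factor M2 / M1 of G
   with M2 <= N. Deflation is multiplicative along normal series, so it suffices
   that the sum of |X| mu(X, G) over M1 <= X <= G with X M2 = G vanishes. Let C be
   the centraliser of M2 / M1 in G. A maximal subgroup Y >= M1 supplementing M2 but
   not containing C would make C / (Y :&: C) a second copy of S; hence only the X
   containing C contribute. Now G / (M2 C) embeds in Out S, so G has a normal
   subgroup P >= M2 C with P / (M2 C) a p-group and G / P generated by some P g.
   For X supplementing M2 C, counting pairs (T, x) with T in Syl_p(X :&: P) and x in
   X :&: P g normalising T gives |X :&: P|, and Moebius inversion, by induction on
   the p-subgroups R in decreasing order, reduces this count to the pairs (R, x)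
   with R a p-subgroup normalised by x and <R, x> <= X. Such an <R, x> is
   solvable, so it cannot supplement C in G, and the sum is 0. *)

Require Import Defs.
From HB Require Import structures.
From mathcomp Require Import all_boot all_order all_algebra all_fingroup all_solvable.
From mathcomp Require Import ring.

Set Implicit Arguments.
Unset Strict Implicit.
Unset Printing Implicit Defensive.

Import GRing.Theory Num.Theory GroupScope.

(** * Moebius sums over intervals of subgroups *)

Section MobiusSums.

Variables (gT : finGroupType) (G : {group gT}).
Implicit Types A C M N U X Y Z : {group gT}.

Lemma eq_group X Y : (X == Y) = (X :==: Y).
Proof. by []. Qed.

(** Each recursive call passes to a strictly larger subgroup, so [#|G| - #|X|] units of fuel are
    enough to reach [G], and any surplus leaves the value unchanged. *)
Lemma mobius_fuel_stable n m X :
    X \subset G -> #|G| <= #|X| + n -> #|G| <= #|X| + m ->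
  mobius_fuel n G X = mobius_fuel m G X.
Proof.
have base k Y : Y \subset G -> #|G| <= #|Y| + 0 ->
  mobius_fuel k G Y = 1%R.
  rewrite addn0 => sYG leGY; have/eqP eYG: Y :==: G by rewrite eqEcard sYG.
  by case: k => [|k] /=; rewrite eYG eqxx.
elim: n m X => [|n IHn] m X sXG; first by move=> *; rewrite !base.
case: m => [|m] len lem; first by rewrite !base.
rewrite /=; case: eqP => // _; congr (- _)%R.
apply: eq_bigr => Y /andP[/proper_card ltXY sYG].
by apply: IHn => //; [apply: leq_trans len _ | apply: leq_trans lem _];
   rewrite addnS ltn_add2r.
Qed.

Definition mu (X : {set gT}) : rat := ((mobius X G)%:~R)%R.

Lemma muG : mu G = 1%R.
Proof. by rewrite /mu /mobius /= eqxx. Qed.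

Lemma sum_mu X :
  X \subset G ->
  (\sum_(Y : {group gT} | (X \subset Y) && (Y \subset G)) mu Y)%R =
    (X :==: G)%:R%R.
Proof.
move=> sXG; rewrite (bigD1 X) ?subxx //=.
have [eXG | neXG] := eqVneq (X : {set gT}) G.
  rewrite eXG muG big1 ?addr0 // => Y /andP[/andP[sGY sYG] /eqP[]].
  by apply/val_inj/eqP; rewrite /= eqEsubset eXG sGY sYG.
rewrite {1}/mu /mobius /= (negPf neXG) rmorphN rmorph_sum /=.
rewrite addrC; apply/eqP; rewrite subr_eq0; apply/eqP.
apply: eq_big => [Y | Y].
  by rewrite eq_group eq_sym properEneq andbC andbA.
case/andP=> /andP[_ sYG] _.
(* Unfolding [mobius] once leaves fuel [#|G|], one unit less than [mobius] grants to [Y]; stability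
   identifies the two values. *)
by rewrite /mu /mobius (@mobius_fuel_stable _ #|G|) ?addnS ?leqW ?leq_addl.
Qed.

(** Weisner's theorem, in its form for meets. The sum of [mu] over all [X] above [U] is 0; splitting
    it by the value [V] of [X :&: Z], the classes with [V] larger than [U] vanish by induction, so
    the class of [U] does too. *)
Lemma weisner U Z :
    U \subset Z -> Z \proper G ->
  (\sum_(X : {group gT} | (X \subset G) && (X :&: Z == U)) mu X = 0)%R.
Proof.
move=> sUZ pZG; have [sZG neZG] := andP pZG.
have [k] := ubnP (#|Z| - #|U|); elim: k U sUZ => // k IHk U sUZ lek.
have sUG := subset_trans sUZ sZG.
have/esym := sum_mu sUG.
have ->: (U :==: G) = false.
  by apply: contraNF neZG => /eqP <-.
rewrite mulr0n.
rewrite (partition_big (fun X => X :&: Z)%G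
          (fun V : {group gT} => (U \subset V) && (V \subset Z))) /=; last first.
  by move=> X /andP[sUX _]; rewrite subsetI sUX sUZ subsetIr.
rewrite (bigD1 U) ?subxx //= [X in (_ + X)%R]big1 ?addr0 => [eS | V].
  rewrite [RHS]eS; apply: eq_bigl => X; rewrite eq_group /=.
  by case: eqP => [<- | _]; rewrite ?subsetIl ?andbT ?andbF.
case/andP=> /andP[sUV sVZ] neVU; rewrite -[RHS](IHk V) //.
  apply: eq_bigl => X; rewrite eq_group /=.
  case: eqP => [eXZ | _]; rewrite ?andbF ?andbT //.
  by rewrite (subset_trans sUV) // -eXZ subsetIl.
have ltUV: U \proper V.
  by rewrite properEneq sUV andbT; apply: contraNneq neVU => eUV; apply/eqP/val_inj.
move: lek; rewrite ltnS; apply: leq_trans.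
by rewrite ltn_sub2l ?proper_card ?(proper_sub_trans ltUV).
Qed.


(** [phi] is constant on each class of subgroups with the same meet with [Z], and [weisner] kills
    every class. *)
Lemma sum_mu_meet A Z (phi : {set gT} -> rat) :
    A \subset Z -> Z \proper G ->
  (\sum_(X : {group gT} | (A \subset X) && (X \subset G))
      mu X * phi (X :&: Z) = 0)%R.
Proof.
move=> sAZ pZG.
rewrite (partition_big (fun X => X :&: Z)%G
          (fun U : {group gT} => (A \subset U) && (U \subset Z))) /=; last first.
  by move=> X /andP[sAX _]; rewrite subsetI sAX sAZ subsetIr.
apply: big1 => U /andP[sAU sUZ].
transitivity ((\sum_(X : {group gT} | (X \subset G) && (X :&: Z == U)) mu X)
                 * phi U)%R; last by rewrite weisner // mul0r.
rewrite mulr_suml; apply: eq_big => [X | X]; rewrite eq_group /=.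
  case: eqP => [eXZ | _]; rewrite ?andbF ?andbT //.
  by rewrite (subset_trans sAU) // -eXZ subsetIl.
by case/andP=> _ /eqP->.
Qed.

(** The vanishing conditions form a triangular system: the one at [Z] determines the value at [Z]
    from the values above it, so descending induction from [G] applies. *)
Lemma mobius_uniq M (a b : {group gT} -> rat) :
    a G = b G ->
    (forall Z, M \subset Z -> Z \proper G ->
       \sum_(Y : {group gT} | (Z \subset Y) && (Y \subset G)) a Y = 0)%R ->
    (forall Z, M \subset Z -> Z \proper G ->
       \sum_(Y : {group gT} | (Z \subset Y) && (Y \subset G)) b Y = 0)%R ->
  forall Y, M \subset Y -> Y \subset G -> a Y = b Y.
Proof.
move=> eG a0 b0 Y; have [k] := ubnP (#|G| - #|Y|).
elim: k Y => // k IHk Y lek sMY sYG.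
have [eYG | neYG] := eqVneq Y G; first by rewrite eYG.
have pYG: Y \proper G by rewrite properEneq sYG andbT.
have := etrans (a0 Y sMY pYG) (esym (b0 Y sMY pYG)).
rewrite (bigD1 Y) ?subxx //= [in RHS](bigD1 Y) ?subxx //=.
rewrite (eq_bigr b) => [e | X /andP[/andP[sYX sXG] neXY]]; first exact: (addIr _ e).
apply: IHk => //; last exact: subset_trans sYX.
move: lek; rewrite ltnS; apply: leq_trans; rewrite ltn_sub2l ?proper_card //.
by rewrite properEneq sYX andbT eq_sym.
Qed.

(* For A = 1 this is |G| m_{G,N}. *)
Definition bsum (A N : {set gT}) : rat :=
  (\sum_(X : {group gT} | [&& A \subset X, X \subset G & (X * N)%g == G])
      #|X|%:R * mu X)%R.

(** Group the [X] by [Y = X <*> M]; then [#|X|] is [#|Y| / #|M|] times [#|X :&: M|]. The inner sums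
    [a Y], weighted by [#|X :&: M|], obey the recursion of [mu] above [M], so [a Y = mu Y * a G] and
    the double sum factors. *)
Lemma bsumM A M N :
    A \subset M -> M <| G -> M \subset N ->
  (bsum A N * #|G|%:R = bsum A M * bsum M N)%R.
Proof.
move=> sAM nsMG sMN; have [sMG nMG] := andP nsMG.
have eJ X : X \subset G -> X <*> M = X * M.
  by move=> sXG; rewrite norm_joinEl ?(subset_trans sXG).
have sJG X : X \subset G -> X <*> M \subset G by move=> sXG; rewrite join_subG sXG.
pose a Y : rat := (\sum_(X : {group gT} |
   ((A \subset X) && (X \subset G)) && (X <*> M == Y)) mu X * #|X :&: M|%:R)%R.
have cM: (#|M|%:R != 0 :> rat)%R by rewrite pnatr_eq0 -lt0n.
have eX X Y : X \subset G -> X <*> M = Y ->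
  (#|X|%:R = #|Y|%:R / #|M|%:R * #|X :&: M|%:R :> rat)%R.
  move=> sXG <-; apply/(mulIf cM); rewrite mulrAC divfK // -!natrM eJ //.
  by rewrite mul_cardG.
have aE Y : M \subset Y -> Y \subset G -> a Y = (mu Y * a G)%R.
  move=> sMY sYG.
  apply: (@mobius_uniq M a (fun Y => mu Y * a G)%R) => // [|Z sMZ pZG|Z sMZ pZG].
  - by rewrite muG mul1r.
  (* By the modular law [(X :&: Z) * M] is the meet of [X * M] with [Z], so the condition that [Z]
     lies in [X <*> M] depends on [X :&: Z] alone and [sum_mu_meet] applies. *)
  - pose phi (U : {set gT}) : rat := (((U * M)%g == Z)%:R * #|U :&: M|%:R)%R.
    rewrite -[RHS](sum_mu_meet phi (subset_trans sAM sMZ) pZG).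
    rewrite /a (exchange_big_dep
      (fun X : {group gT} => (A \subset X) && (X \subset G))) //=; last first.
      by move=> ? ? _ /andP[].
    apply: eq_bigr => X /andP[sAX sXG]; rewrite /phi.
    have ->: X :&: Z :&: M = X :&: M by rewrite -setIA (setIidPr sMZ).
    have ->: ((X :&: Z) * M == Z) = (Z \subset X <*> M).
      by rewrite eJ // setIC group_modr // (sameP setIidPl eqP).
    case: (boolP (Z \subset _)) => sZX; last first.
      rewrite mul0r mulr0 big_pred0 // => V; apply: contraNF sZX.
      by case/andP=> /andP[sZY _] /andP[_ /eqP->].
    rewrite mul1r (big_pred1 (X <*> M)%G) // => V.
    rewrite /= sAX sXG eq_group /= [RHS]eq_sym.
    case: eqP => [<- | _]; last by rewrite andbF.
    by rewrite sZX sJG.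
  rewrite -mulr_suml sum_mu ?(proper_sub pZG) //.
  by rewrite eqEproper pZG andbF mul0r.
have partE N' : M \subset N' ->
   bsum A N' = (\sum_(Y : {group gT} | [&& M \subset Y, Y \subset G & (Y * N')%g == G])
     #|Y|%:R / #|M|%:R * a Y)%R.
  move=> sMN'; rewrite /bsum (partition_big (fun X => X <*> M)%G
     (fun Y : {group gT} => [&& M \subset Y, Y \subset G & Y * N' == G])) /=.
    apply: eq_bigr => Y /and3P[sMY sYG /eqP YN]; rewrite /a mulr_sumr.
    apply: eq_big => [X | X]; rewrite eq_group /=.
      have [sXG | //] := boolP (X \subset G); rewrite ?andbF //=.
      have [eXY | _] := eqVneq (X <*> M) Y; rewrite ?andbF ?andbT //.
      have: X * M * N' = Y * N' by rewrite -eJ // eXY.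
      by rewrite -mulgA (mulSGid sMN') YN => ->; rewrite eqxx andbT.
    case/andP=> /and3P[_ sXG _] /eqP eXY.
    by rewrite (eX X Y) // mulrAC [RHS]mulrA.
  move=> X /and3P[_ sXG /eqP XN]; rewrite joing_subr sJG // eJ //=.
  by rewrite -mulgA (mulSGid sMN') XN eqxx.
have ->: bsum A M = (#|G|%:R / #|M|%:R * a G)%R.
  rewrite partE // (big_pred1 G) // => Y; rewrite /= eq_group /=.
  apply/and3P/eqP => [[sMY _ /eqP]|->]; first by rewrite mulGSid.
  by rewrite sMG subxx mulGSid ?eqxx.
rewrite partE // /bsum mulr_suml mulr_sumr; apply: eq_bigr => Y /and3P[sMY sYG _].
by rewrite aE //; ring.
Qed.


(* By induction, only the subgroups above X <*> C contribute to the recursion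
   for mu X, and X <*> C is proper. *)
Lemma mu_supplement_eq0 A M C :
    (forall Y, maximal Y G -> A \subset Y -> Y * M = G -> C \subset Y) ->
    C \subset G ->
  forall X, A \subset X -> X \subset G -> X * M = G -> ~~ (C \subset X) ->
  mu X = 0%R.
Proof.
move=> maxC sCG X; have [k] := ubnP (#|G| - #|X|).
elim: k X => // k IHk X lek sAX sXG eXM nCX.
have up Y : X \subset Y -> Y \subset G -> Y * M = G.
  move=> sXY sYG; apply/eqP; rewrite eqEsubset -{2}eXM mulSg // andbT.
  by rewrite mul_subG // -eXM mulG_subr.
have neXG: (X :==: G) = false by apply: contraNF nCX => /eqP->.
have pJ: X <*> C \proper G.
  case: (maximal_exists sXG) => [eXG | [Y maxY sXY]].
    by rewrite eXG eqxx in neXG.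
  have pYG := maxgroupp maxY; apply: sub_proper_trans pYG.
  rewrite join_subG sXY maxC ?(subset_trans sAX) // up //.
  by case/maxgroupP: maxY => /proper_sub.
have := sum_mu sXG; rewrite neXG mulr0n (bigD1 X) ?subxx //=.
rewrite [X in (_ + X)%R](_ : _ = 0%R) ?addr0 //.
rewrite (bigID (fun Y : {group gT} => C \subset Y)) /= [X in (_ + X)%R]big1.
  rewrite addr0; have:= sum_mu (proper_sub pJ).
  have ->: (X <*> C :==: G) = false by rewrite eqEproper pJ andbF.
  rewrite mulr0n => e; rewrite -[RHS]e; apply: eq_bigl => Y; rewrite join_subG eq_group.
  have [sCY|] := boolP (C \subset Y); rewrite !(andbT, andbF) //.
  case: eqP => [eYX | _]; rewrite ?andbT //.
  by rewrite -eYX sCY in nCX.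
move=> Y /andP[/andP[/andP[sXY sYG] neYX] nCY].
apply: IHk; rewrite ?up ?(subset_trans sAX) //.
move: lek; rewrite ltnS; apply: leq_trans; rewrite ltn_sub2l ?proper_card //.
  by rewrite properEneq neXG.
by rewrite properEneq sXY andbT eq_sym.
Qed.

Lemma bsum_supplement A M C :
    (forall Y, maximal Y G -> A \subset Y -> Y * M = G -> C \subset Y) ->
    A \subset C -> C \subset G ->
  bsum A M = bsum C M.
Proof.
move=> maxC sAC sCG; rewrite /bsum (bigID (fun Y : {group gT} => C \subset Y)) /=.
rewrite [X in (_ + X)%R]big1 ?addr0 => [|X /andP[/and3P[sAX sXG /eqP eXM] nCX]].
  apply: eq_bigl => X; have [sCX|] := boolP (C \subset X); rewrite ?andbF //.
  by rewrite andbT (subset_trans sAC).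
by rewrite (mu_supplement_eq0 maxC sCG sAX) ?mulr0.
Qed.

End MobiusSums.

(** * Vanishing of Moebius sums for cyclic-mod-p quotients *)

Section SylowCosetCount.

Variables (p : nat) (gT : finGroupType).
Implicit Types H K P T X : {group gT}.

Lemma rcosetI_card H P g h :
  h \in H :&: P :* g -> #|H :&: P :* g| = #|H :&: P|.
Proof.
case/setIP=> Hh; rewrite rcoset_sym => /rcoset_eqP ->.
suff ->: H :&: P :* h = (H :&: P) :* h by rewrite card_rcoset.
apply/setP=> x; rewrite inE !mem_rcoset inE; congr (_ && _).
by rewrite groupMr ?groupV.
Qed.

(** For the converse, if [T] were proper in a Sylow subgroup [Q] of [K], then ['N_Q(T)] would be a
    p-subgroup of ['N_K(T)] strictly larger than [T], since normalisers grow in p-groups. *)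
Lemma Sylow_normI K T : p.-Sylow(K) T = p.-Sylow('N_K(T)) T.
Proof.
apply/idP/idP => [sylT | sylT].
  have sTN: T \subset 'N_K(T) by rewrite subsetI (pHall_sub sylT) normG.
  by apply: pHall_subl sylT; rewrite ?subsetIl.
have pT := pHall_pgroup sylT; have sTN := pHall_sub sylT.
have sTK: T \subset K by rewrite (subset_trans sTN) ?subsetIl.
have [Q sylQ sTQ] := Sylow_superset sTK pT.
have pQ := pHall_pgroup sylQ.
have [eTQ | neTQ] := eqVneq T Q; first by rewrite eTQ.
have pTQ: T \proper Q by rewrite properEneq neTQ.
have := nilpotent_proper_norm (pgroup_nil pQ) pTQ.
rewrite properE => /andP[_ /negP[]].
have sNN: 'N_Q(T) \subset 'N_K(T) by rewrite setSI // (pHall_sub sylQ).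
have sTNQ : T \subset 'N_Q(T) by rewrite subsetI sTQ normG.
by rewrite (sub_pHall sylT (pgroupS (subsetIl Q _) pQ) sTNQ sNN).
Qed.

(* Frattini argument: H acts transitively on Syl_p(H :&: P), and each stabiliser
   meets the coset in a coset of its intersection with P. *)
Lemma sum_Sylow_coset H P g :
    H \subset 'N(P) ->
  \sum_(T : {group gT} | p.-Sylow(H :&: P) T) #|H :&: 'N(T) :&: P :* g| =
    #|H :&: P :* g|.
Proof.
move=> nPH; set K := (H :&: P)%G.
have nsKH: K <| H by rewrite /normal subsetIl normsI ?normG.
have [H0 | [h HPh]] := set_0Vmem (H :&: P :* g).
  rewrite H0 cards0 big1 // => T _; apply/eqP; rewrite cards_eq0 -subset0 -H0.
  by rewrite setSI ?subsetIl.
have cardN T : p.-Sylow(K) T -> (#|'Syl_p(K)| * #|H :&: 'N(T) :&: P :* g|)%N = #|K|.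
  move=> sylT; have := Frattini_arg nsKH sylT.
  have [Hh Ph] := setIP HPh => eH; have: h \in K * 'N_H(T) by rewrite eH.
  case/mulsgP=> y k Ky Nk ehk.
  have Nk': k \in 'N_H(T) :&: P :* g.
    rewrite inE Nk mem_rcoset; have ->: k = y^-1 * h by rewrite ehk mulKg.
    rewrite -mulgA groupM ?groupV -?mem_rcoset //.
    by case/setIP: Ky.
  rewrite (rcosetI_card Nk') (card_Syl sylT) mulnC /= setIAC.
  by rewrite Lagrange ?subsetIl.
rewrite (rcosetI_card HPh).
have Syl_gt0: 0 < #|'Syl_p(K)|.
  by have [T sylT] := Sylow_exists p K; apply/card_gt0P; exists T; rewrite inE.
apply/eqP; rewrite -(eqn_pmul2l Syl_gt0) big_distrr /=; apply/eqP.
rewrite (eq_bigr (fun => #|K|)) // sum_nat_const; congr (_ * _)%N.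
by apply: eq_card => T; rewrite inE.
Qed.

End SylowCosetCount.

Section CyclicModP.

Variables (p : nat) (gT : finGroupType) (G C N P : {group gT}) (g : gT).
Implicit Types D R T X : {group gT}.

Hypotheses (nsNG : N <| G) (nsPG : P <| G) (sNP : N \subset P).
Hypotheses (pPN : p.-group (P / N)) (Gg : g \in G) (cycGP : G / P = <[coset P g]>).
Hypothesis notcycG : forall R x,
  R \subset G -> p.-group R -> x \in 'N_G(R) -> C <*> (R <*> <[x]>) \proper G.

Local Notation E := (P :* g).

(** The contribution of a fixed [T] to the weighted count of pairs [(T, x)]. The parameter [D]
    allows the ambient group to shrink to the normaliser of [T] during the induction. *)
Definition Sylow_sum (D T : {group gT}) : rat :=
  (\sum_(X : {group gT} | (C \subset X) && (X \subset G))
     mu G X * (p.-Sylow(X :&: D :&: P) T * #|X :&: D :&: 'N(T) :&: E|)%N%:R)%R.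

Lemma Sylow_sum_norm D T : Sylow_sum D T = Sylow_sum (D :&: 'N(T))%G T.
Proof.
apply: eq_bigr => X _; congr (_ * (nat_of_bool _ * _)%N%:R)%R => /=.
  rewrite (Sylow_normI p (X :&: D :&: P)) (Sylow_normI p (X :&: _ :&: P)) /=.
  by congr (p.-Sylow(_) T); rewrite -!setIA [in RHS](setICA 'N(T)) setIid.
by rewrite -!setIA [in RHS](setIA 'N(T)) setIid.
Qed.

(* Each x counted on the left contributes the sum of mu over all X above the
   proper subgroup C <*> (R <*> <[x]>), which is 0. *)
Lemma sum_mu_norm_coset D R :
    D \subset 'N(R) -> p.-group R -> R \subset G ->
  (\sum_(X : {group gT} | (C \subset X) && (X \subset G))
     mu G X * ((R \subset X) * #|X :&: D :&: E|)%N%:R = 0)%R.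
Proof.
move=> nRD pR sRG.
transitivity (\sum_(x in G :&: D :&: E)
    \sum_(X : {group gT} | (C <*> (R <*> <[x]>) \subset X) && (X \subset G))
       mu G X)%R; last first.
  apply: big1 => x /setIP[/setIP[Gx Dx] _].
  have Nx: x \in 'N_G(R) by rewrite inE Gx (subsetP nRD).
  have pJ := notcycG sRG pR Nx.
  by rewrite sum_mu ?(proper_sub pJ) // eqEproper pJ andbF.
rewrite (exchange_big_dep
  (fun X : {group gT} => (C \subset X) && (X \subset G))) /=; last first.
  by move=> x X _ /andP[]; rewrite join_subG => /andP[->].
apply: eq_bigr => X /andP[sCX sXG]; rewrite sumr_const mulr_natr.
congr (_ *+ _)%R; rewrite mulnC; have [sRX | nRX] := boolP (R \subset X).
  rewrite muln1; apply: eq_card => x; rewrite [RHS]unfold_in /= !inE.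
  rewrite sXG !join_subG sCX sRX cycle_subG.
  rewrite andbT /=; have [Xx | _] := boolP (x \in X); rewrite ?andbF ?andbT //.
  by rewrite (subsetP sXG).
rewrite muln0; apply/esym/eq_card0 => x.
by rewrite unfold_in /= !join_subG (negPf nRX) !andbF.
Qed.

(** Descending induction on [R]. Since [D] normalises [R], summing over all [T] above [R] gives the
    sum of [sum_mu_norm_coset], which is 0. For [T] larger than [R], replacing [D] by [D :&: 'N(T)]
    makes the induction hypothesis applicable, so only the term of [R] is left. *)
Lemma Sylow_sum_eq0 D R : D \subset 'N(R) -> Sylow_sum D R = 0%R.
Proof.
have [k] := ubnP (#|gT| - #|R|); elim: k D R => // k IHk D R lek nRD.
(* Otherwise [R] is a Sylow subgroup of no [X :&: D :&: P], and every summand is 0. *)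
have [/and3P[pR sRG sRDP] | nR] :=
    boolP [&& p.-group R, R \subset G & R \subset D :&: P]; last first.
  apply: big1 => X /andP[_ sXG].
  have [sylR | _] := boolP (p.-Sylow(X :&: D :&: P) R); last by rewrite mul0n mulr0.
  have sR := pHall_sub sylR; case/negP: nR; rewrite (pHall_pgroup sylR).
  rewrite -!setIA in sR; rewrite (subset_trans sR) ?(subset_trans sR) ?subsetIr //.
  by rewrite subIset ?sXG.
have := sum_mu_norm_coset nRD pR sRG.
suff ->: (\sum_(X : {group gT} | (C \subset X) && (X \subset G))
     mu G X * ((R \subset X) * #|X :&: D :&: E|)%N%:R =
  \sum_(T : {group gT} | R \subset T) Sylow_sum D T)%R.
  rewrite (bigD1 R) //= big1 ?addr0 // => T /andP[sRT neTR].
  rewrite Sylow_sum_norm IHk ?subsetIr //.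
  have pRT: R \proper T by rewrite properEneq sRT andbT eq_sym.
  have ltRT := proper_card pRT.
  move: lek; rewrite ltnS; apply: leq_trans; apply: ltn_sub2l => //.
  exact: leq_trans ltRT (max_card _).
rewrite exchange_big /=; apply: eq_bigr => X /andP[sCX sXG].
rewrite -mulr_sumr -natr_sum; congr (_ * _%:R)%R.
have nPX: X :&: D \subset 'N(P).
  exact: subset_trans (subsetIl _ _) (subset_trans sXG (normal_norm nsPG)).
have [sRX | nRX] := boolP (R \subset X); last first.
  rewrite mul0n big1 // => T sRT.
  have [sylT | //] := boolP (p.-Sylow(_) T); case/negP: nRX.
  rewrite (subset_trans sRT) // (subset_trans (pHall_sub sylT)) //.
  by rewrite -setIA subsetIl.
rewrite mul1n -(sum_Sylow_coset p g nPX) big_mkcond [RHS]big_mkcond /=.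
apply: eq_bigr => T _; have [sylT | _] := boolP (p.-Sylow(_) T); last first.
  by rewrite mul0n if_same.
(* [R] is a normal p-subgroup of [X :&: D :&: P], hence lies in each of its Sylow subgroups: the
   restriction to [T] above [R] loses nothing. *)
rewrite mul1n ifT // (subset_trans _ (pcore_sub_Hall sylT)) // pcore_max //.
have [sRD sRP] := subsetIP sRDP; rewrite /normal /= !subsetI sRX sRD sRP /=.
exact: subset_trans (subsetIl _ _) (subset_trans (subsetIr _ _) nRD).
Qed.

(** If [X * N = G], then [#|X|] is [#|G : P|] times [#|X :&: P|], and the latter counts pairs
    [(T, x)]. The condition [T * N = P] makes the same count vanish for every other [X], so the
    whole sum is a combination of [Sylow_sum G T]. *)
Lemma bsum_cyclic_mod_eq0 : bsum G C N = 0%R.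
Proof.
have nPG := normal_norm nsPG; have nNG := normal_norm nsNG.
suff ->: bsum G C N = (#|G : P|%:R *
    \sum_(T : {group gT} | (T * N)%g == P) Sylow_sum G T)%R.
  by rewrite big1 ?mulr0 // => T _; rewrite Sylow_sum_norm Sylow_sum_eq0 ?subsetIr.
rewrite exchange_big mulr_sumr /bsum /=.
rewrite [LHS](eq_bigl (fun X : {group gT} =>
   ((C \subset X) && (X \subset G)) && ((X * N)%g == G))); last first.
  by move=> X; rewrite andbA.
rewrite big_mkcondr /=; apply: eq_bigr => X /andP[sCX sXG].
rewrite -mulr_sumr -natr_sum mulrCA mulrC.
have nPX := subset_trans sXG nPG; have nNX := subset_trans sXG nNG.
have eXG : X :&: G = X by apply/setIidPl.
(* A pair [(T, x)] with [T * N = P] would put both [P] and [x], a generator of [G] modulo [P],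
   inside [X * N], forcing [X * N = G]. *)
have [eXN | neXN] := eqVneq (X * N) G; last first.
  rewrite [X in (_ * X)%R](_ : _ = 0)%R ?mulr0 ?mul0r //.
  rewrite big1 ?mulr0 // => T /eqP eTN; rewrite eXG.
  have [sylT | _] := boolP (p.-Sylow(X :&: P) T); rewrite ?mul0n // mul1n.
  apply/eqP; rewrite cards_eq0; apply: contraNT neXN => /set0Pn[x].
  rewrite !inE => /andP[/andP[Xx _] Ex].
  have eJ: X <*> N = X * N by rewrite norm_joinEl.
  have sNG := normal_sub nsNG; rewrite eqEsubset mul_subG // -eJ.
  have sPJ: P \subset X <*> N.
    rewrite eJ -eTN mulSg // (subset_trans (pHall_sub sylT)) ?subsetIl //.
  rewrite -(quotientSGK nPG sPJ) cycGP cycle_subG.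
  have ->: coset P g = coset P x.
    by case/rcosetP: Ex => y Py ->; rewrite coset_kerl.
  by rewrite mem_quotient // mem_gen // inE Xx.
have [x XEx] : exists x, x \in X :&: E.
  have /mulsgP[x n Xx Nn eg] : g \in X * N by rewrite eXN.
  exists x; rewrite inE Xx rcoset_sym eg mem_rcoset.
  have ->: x * n * x^-1 = n ^ x^-1 by rewrite conjgE invgK mulgA.
  by rewrite memJ_norm ?groupV ?(subsetP sNP) // (subsetP nPX).
(* By the modular law [X :&: P] covers the p-group [P / N]; a Sylow subgroup of it therefore covers
   [P / N] as well. *)
have sylE T : p.-Sylow(X :&: P) T -> T * N = P.
  move=> sylT; have sTP := subset_trans (pHall_sub sylT) (subsetIr _ _).
  have nNT := subset_trans (pHall_sub sylT) (subset_trans (subsetIl _ _) nNX).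
  have eXPN : (X :&: P) * N = P.
    by rewrite setIC group_modr // eXN; apply/setIidPl/normal_sub.
  have sylTN := quotient_pHall nNT sylT.
  have eq1: (X :&: P) / N = P / N by rewrite -quotientMidr eXPN.
  rewrite eq1 in sylTN; have /= eTP := pHall_id sylTN pPN.
  apply/eqP; rewrite eqEsubset mul_subG //=.
  have nNP := subset_trans (normal_sub nsPG) nNG.
  rewrite -norm_joinEl // -(quotientSGK nNP) ?joing_subr //.
  by rewrite /= quotientYidr // eTP.
have ->: \sum_(T : {group gT} | (T * N)%g == P)
   (p.-Sylow(X :&: G :&: P) T * #|X :&: G :&: 'N(T) :&: E|) = #|X :&: P|.
  rewrite -(rcosetI_card XEx) -(sum_Sylow_coset p g nPX) eXG.
  rewrite big_mkcond [RHS]big_mkcond /=; apply: eq_bigr => T _.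
  have [sylT | _] := boolP (p.-Sylow(_) T); last by rewrite mul0n if_same.
  by rewrite mul1n ifT // sylE.
rewrite -natrM; congr (_ * _%:R)%R.
have eXP: X * P = G.
  apply/eqP; rewrite eqEsubset mul_subG ?(normal_sub nsPG) //=.
  by have := mulgS X sNP; rewrite eXN.
have := mul_cardG X P; rewrite eXP -(Lagrange (normal_sub nsPG)).
rewrite mulnC -mulnA => /eqP; rewrite eqn_pmul2l ?cardG_gt0 // => /eqP->.
by [].
Qed.

End CyclicModP.

(** * Composition factors *)

Section CompositionFactors.

Variables (sT : finGroupType) (S : {group sT}).

Local Notation comp_path := (path [rel x y : {group _} | maxnormal y x x]).

Lemma comp_factor_count_cat (gT : finGroupType) (H : {group gT}) s1 s2 :
  comp_factor_count S H (s1 ++ s2) =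
    (comp_factor_count S H s1 + comp_factor_count S (last H s1) s2)%N.
Proof.
elim: s1 H => //= K s1 IHs H; rewrite /comp_factor_count /=.
by rewrite -!/(comp_factor_count _ _ _) IHs addnA.
Qed.

Lemma comp_factor_count_cons (gT : finGroupType) (H K : {group gT}) s :
  comp_factor_count S H (K :: s) = (((H / K)%g \isog S) + comp_factor_count S K s)%N.
Proof. by []. Qed.

(** Jordan-Hölder: passing to canonical section representatives turns the count into one over
    [mkfactors], which is unique up to permutation. *)
Lemma comp_factor_count_uniq (gT : finGroupType) (H : {group gT}) s1 s2 :
  comps H s1 -> comps H s2 -> comp_factor_count S H s1 = comp_factor_count S H s2.
Proof.
move=> cs1 cs2.
suff E s : comp_factor_count S H s =
    count (fun q : section gT => (q : {set _}) \isog S) (mkfactors H s).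
  by rewrite !E; apply/(seq.permP _); apply: JordanHolderUniqueness.
elim: s H {cs1 cs2} => // K s IHs H; rewrite comp_factor_count_cons IHs /=.
by rewrite (isog_transl _ (section_reprP _)).
Qed.

Lemma comp_path_exists (gT : finGroupType) (H K : {group gT}) :
  K <| H -> exists2 s, comp_path H s & last H s = K.
Proof.
have [k] := ubnP #|H|; elim: k H => // k IHk H leH nsKH.
have [-> | neKH] := eqVneq K H; first by exists [::].
pose gP (A : {group gT}) := (A \proper H) && (H \subset 'N(A)).
have gPK : gP K.
  by rewrite /gP properEneq neKH normal_sub // normal_norm.
have [L maxL sKL] := maxgroup_exists (gP := gP) gPK.
have maxL' : maxnormal L H H by [].
have sLH := normal_sub (maxnormal_normal maxL').
have [||s cs es] := IHk L.
- by rewrite -ltnS (leq_trans _ leH) // ltnS proper_card // (maxnormal_proper maxL').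
- exact: normalS nsKH.
by exists (L :: s) => //=; rewrite maxL'.
Qed.

Lemma comps_path (gT : finGroupType) (H K : {group gT}) s t :
  comp_path H s -> last H s = K -> comps K t -> comps H (s ++ t).
Proof.
move=> cs es /compsP[et ct]; apply/compsP.
by rewrite last_cat cat_path es cs.
Qed.

Lemma maxnormal_isog (gT : finGroupType) (H K : {group gT}) :
  simple S -> K <| H -> (H / K)%g \isog S -> maxnormal K H H.
Proof. by move=> simS nsKH iso; rewrite -quotient_simple // (isog_simple iso). Qed.

(** The chain from [G] through [A], [B], [C] and [D] to 1 refines to a composition series that keeps
    the simple quotients [A / B] and [C / D] as factors; uniqueness carries the count over to
    [s]. *)
Lemma two_comp_factors (gT : finGroupType) (G A B C D : {group gT}) s :
    simple S -> comps G s ->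
    A <| G -> B <| A -> C <| B -> D <| C ->
    (A / B)%g \isog S -> (C / D)%g \isog S ->
  1 < comp_factor_count S G s.
Proof.
move=> simS cGs nsAG nsBA nsCB nsDC isoAB isoCD.
have [s1 c1 e1] := comp_path_exists nsAG.
have [s2 c2 e2] := comp_path_exists nsCB.
have [t ct] := exists_comps D.
have cC : comps C (D :: t).
  by apply: (@comps_path _ C D [:: D]) => //=; rewrite maxnormal_isog.
have cA : comps A (B :: s2 ++ D :: t).
  by apply: (@comps_path _ A C (B :: s2)) cC => //=; rewrite maxnormal_isog.
rewrite (comp_factor_count_uniq cGs (comps_path c1 e1 cA)).
rewrite comp_factor_count_cat e1 comp_factor_count_cons isoAB.
rewrite comp_factor_count_cat e2 comp_factor_count_cons isoCD.
by rewrite !(addnCA _ (nat_of_bool true)).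
Qed.

Lemma comp_path_sub (gT : finGroupType) (H : {group gT}) s :
  comp_path H s -> last H s \subset H.
Proof.
elim: s H => //= K s IHs H /andP[maxK /IHs/subset_trans->] //.
exact: normal_sub (maxnormal_normal maxK).
Qed.

Lemma solvable_comp_factor_count (gT : finGroupType) (H K : {group gT}) s :
    ~~ solvable S -> K <| H -> solvable (H / K) ->
    comp_path H s -> last H s = K ->
  comp_factor_count S H s = 0%N.
Proof.
move=> nsolS; elim: s H => //= L s IHs H nsKH solHK /andP[maxL cs] es.
have nsLH := maxnormal_normal maxL; have sLH := normal_sub nsLH.
have sKL : K \subset L by rewrite -es comp_path_sub.
have nsKL := normalS sKL sLH nsKH.
rewrite comp_factor_count_cons IHs ?(solvableS (quotientS _ sLH)) // addn0.
apply/eqP; rewrite eqb0; apply: contra nsolS => iso.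
by rewrite -(isog_sol iso) -(isog_sol (third_isog sKL nsKH nsLH)) quotient_sol.
Qed.

Lemma dprod_comps (gT : finGroupType) (T : eqType) (A : T -> {set gT})
    (H W : {group gT}) (r : seq T) :
    simple H -> \big[dprod/1]_(i <- r) A i = W ->
    {in r, forall i, A i \isog H} ->
  exists2 s, comps W s & comp_factor_count S W s = (size r * (H \isog S))%N.
Proof.
move=> simH; elim: r W => [|i r IHr] W.
  rewrite big_nil => eW _; exists [::] => //; apply/compsP; split=> //.
  exact/val_inj.
rewrite big_cons => defW isoA.
have [[K L eK eL] _ _ _] := dprodP defW; rewrite eL in defW.
have [s cs es] := IHr _ eL (fun j rj => isoA j (mem_behead (s := i :: r) rj)).
have isoKH : K \isog H by rewrite -eK isoA ?mem_head.
have [nsLW isoWL] : L <| W /\ (W / L)%g \isog K.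
  rewrite eK in defW; have [_ eW cKL tiKL] := dprodP defW.
  have nLK : K \subset 'N(L) by rewrite cents_norm // centsC.
  split; first by have [] := dprod_normal2 defW.
  have := second_isog nLK; rewrite setIC tiKL => iso1.
  rewrite -eW quotientMidr. rewrite isog_sym.
  by apply: isog_trans (quotient1_isog _) _.
have isoWH := isog_trans isoWL isoKH.
exists (L :: s).
  apply: (@comps_path _ W L [:: L]) cs => //=.
  by rewrite -quotient_simple // (isog_simple isoWH) simH.
by rewrite comp_factor_count_cons es (isog_transl _ isoWH) mulSn.
Qed.

(** [W] is a direct product of automorphic images of a simple [H], so the count is the number of
    images or 0. The value 1 leaves a single direct factor, isomorphic to [S]. *)
Lemma charsimple_isog (gT : finGroupType) (W : {group gT}) s :
  charsimple W -> comps W s -> comp_factor_count S W s = 1%N -> W \isog S.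
Proof.
case/charsimple_dprod=> H [sHW simH [I sIA defW]] cs e1.
rewrite -big_enum /= in defW.
have isoA f : f \in Aut W -> f @: H \isog H.
  move=> Af.
  have ->: f @: H = autm Af @* H by rewrite morphimEsub // autmE.
  by rewrite isog_sym sub_isog ?injm_autm.
have {}isoA f : f \in enum I -> f @: H \isog H.
  by rewrite mem_enum => /(subsetP sIA)/isoA.
have [t ct et] := dprod_comps simH defW isoA.
move: e1; rewrite (comp_factor_count_uniq cs ct) et => /eqP.
rewrite muln_eq1 eqb1 => /andP[sz1 isoHS]; apply: isog_trans isoHS.
case: (enum I) sz1 defW isoA => // f [|//] _.
by rewrite big_cons big_nil dprodg1 => <-; apply; rewrite mem_head.
Qed.

(** Taking preimages preserves each factor by the third isomorphism theorem; the lifted path stops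
    at the kernel [M], ready to be continued below it. *)
Lemma cosetpre_comp_path (gT : finGroupType) (M : {group gT})
    (Q : {group coset_of M}) t :
    comps Q t ->
  exists s, [/\ comp_path (coset M @*^-1 Q)%G s,
                last (coset M @*^-1 Q)%G s = M &
      comp_factor_count S (coset M @*^-1 Q)%G s = comp_factor_count S Q t].
Proof.
case/compsP=> et ct; pose f (R : {group coset_of M}) := (coset M @*^-1 R)%G.
have isoF (R Q' : {group coset_of M}) : R <| Q' -> (f Q' / f R)%g \isog (Q' / R)%g.
  move=> nsRQ; rewrite isog_sym.
  have := @third_isog _ (f Q') M (f R); rewrite !cosetpreK; apply.
  - exact: sub_cosetpre.
  - exact: normal_cosetpre.
  - by rewrite cosetpre_normal.
exists (map f t); elim: t Q et ct => [|R t IHt] Q et /=.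
  by move=> _; split=> //; apply/val_inj; rewrite /= (et : Q = 1%G) -[RHS]ker_coset.
case/andP=> maxR ct; have [p1 l1 c1] := IHt R et ct.
have nsRQ := maxnormal_normal maxR; have iso1 := isoF _ _ nsRQ.
split => //.
  rewrite p1 andbT -quotient_simple ?cosetpre_normal //.
  by rewrite (isog_simple iso1) quotient_simple.
by rewrite !comp_factor_count_cons c1 (isog_transl _ iso1).
Qed.

(** Choose [M] maximal among the proper [G]-invariant subgroups of [N]. If the copy of [S] occurs in
    [M], induct; otherwise it occurs in [N / M], which is characteristically simple and hence
    isomorphic to [S]. *)
Lemma exists_chief_factor (gT : finGroupType) (G N : {group gT}) s :
    N <| G -> comps N s -> comp_factor_count S N s = 1%N ->
  exists M1 M2 : {group gT},
    [/\ M1 <| G, M2 <| G, M1 \subset M2, M2 \subset N & (M2 / M1)%g \isog S].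
Proof.
have [k] := ubnP #|N|; elim: k N s => // k IHk N s leN nsNG cNs eNs.
have [sNG nNG] := andP nsNG.
have neN1 : N :!=: 1.
  by apply: contra_eqN eNs; rewrite (trivg_comps cNs) => /eqP->.
have [M maxM] : {M : {group gT} | maxnormal M N G}.
  by apply: ex_maxgroup; exists 1%G; rewrite norms1 andbT properEneq eq_sym neN1 sub1G.
have [pMN nMG] := andP (maxgroupp maxM); have sMN := proper_sub pMN.
have nsMG : M <| G by rewrite /normal (subset_trans sMN).
have nsMN := normalS sMN sNG nsMG.
have [t ct] := exists_comps (N / M)%G.
have [u [pu lu cu]] := cosetpre_comp_path ct.
have eN : (coset M @*^-1 (N / M))%G = N.
  by apply/val_inj; rewrite /= quotientGK.
rewrite eN in pu lu cu.
have [v cv] := exists_comps M.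
have := comp_factor_count_uniq cNs (comps_path pu lu cv).
rewrite eNs comp_factor_count_cat lu cu.
case ev: (comp_factor_count S M v) => [|[|m]].
- rewrite addn0 => et; exists M, N; split=> //.
  apply: charsimple_isog ct (esym et).
  have chfN : chief_factor G M N by apply/andP.
  exact: minnormal_charsimple (chief_factor_minnormal chfN).
- move=> _; have [|M1 [M2 [? ? ? sM2M ?]]] := IHk M v _ nsMG cv ev.
    by rewrite -ltnS (leq_trans _ leN) // ltnS proper_card.
  by exists M1, M2; split=> //; apply: subset_trans sM2M sMN.
by move/eqP; rewrite !addnS.
Qed.

End CompositionFactors.

(** * Centralisers of chief factors and outer automorphisms *)

Section GroupTheory.

Implicit Types gT : finGroupType.

Lemma simple_nonabelian_nsol gT (S : {group gT}) :
  simple S -> ~~ abelian S -> ~~ solvable S.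
Proof.
move=> simS; apply: contra => solS.
by rewrite cyclic_abelian // prime_cyclic // simple_sol_prime.
Qed.

Lemma simple_nonabelian_center gT (S : {group gT}) :
  simple S -> ~~ abelian S -> 'Z(S) = 1.
Proof.
case/simpleP=> _ simS nabS; case: (simS _ (center_normal S)) => // eZ.
by rewrite -eZ center_abelian in nabS.
Qed.

(** [C] is the centraliser in [G] of [M2 / M1], so [M2 :&: C] maps into the centre of [M2 / M1],
    which is trivial. *)
Lemma cent_simple_factor gT (G M1 M2 : {group gT}) :
    M1 <| G -> M2 <| G -> M1 \subset M2 ->
    simple (M2 / M1) -> ~~ abelian (M2 / M1) ->
  let C := (G :&: coset M1 @*^-1 'C(M2 / M1))%G in
  [/\ C <| G, M1 \subset C, [~: C, M2] \subset M1 & M2 :&: C = M1].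
Proof.
move=> nsM1G nsM2G sM12 simW nabW C.
have [sM1G nM1G] := andP nsM1G; have [sM2G nM2G] := andP nsM2G.
have sCG: C \subset G by apply: subsetIl.
have sM1C: M1 \subset C by rewrite subsetI sM1G sub_cosetpre.
have nM1C := subset_trans sCG nM1G; have nM1M2 := subset_trans sM2G nM1G.
have cCM2: C / M1 \subset 'C(M2 / M1).
  by have := quotientS M1 (subsetIr G (coset M1 @*^-1 'C(M2 / M1))); rewrite cosetpreK.
split=> //.
- rewrite /normal sCG normsI ?normG //.
  apply: subset_trans (morphpre_norm _ _).
  rewrite -sub_quotient_pre // (subset_trans _ (cent_norm _)) //.
  by rewrite quotient_norms.
- by rewrite -quotient_cents2.
apply/eqP; rewrite eqEsubset subsetI sM12 sM1C !andbT.
rewrite -quotient_sub1 ?(subset_trans (subsetIl _ _)) //.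
rewrite -(simple_nonabelian_center simW nabW) subsetI quotientS ?subsetIl //=.
exact: subset_trans (quotientS _ (subsetIr _ _)) cCM2.
Qed.

(* Modulo B = Y :&: C, the subgroup Y is a common complement of the commuting
   normal subgroups M2 and C, which are therefore isomorphic. *)
Lemma maximal_supplement_factor gT (G M1 M2 C Y : {group gT}) :
    M1 <| G -> M2 <| G -> M1 \subset M2 -> simple (M2 / M1) ->
    C <| G -> M1 \subset C -> [~: C, M2] \subset M1 -> M2 :&: C = M1 ->
    maximal Y G -> M1 \subset Y -> Y * M2 = G -> ~~ (C \subset Y) ->
  Y :&: C <| G /\ (C / (Y :&: C))%g \isog (M2 / M1)%g.
Proof.
move=> nsM1G nsM2G sM12 simW nsCG sM1C cCM2 tiM2C maxY sM1Y eYM2 nCY.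
have [sM1G nM1G] := andP nsM1G; have [sM2G nM2G] := andP nsM2G.
have [sCG nCG] := andP nsCG.
have pYG := maxgroupp maxY; have sYG := proper_sub pYG.
have sBC: Y :&: C \subset C := subsetIr _ _.
have sM1B: M1 \subset Y :&: C by rewrite subsetI sM1Y.
(* [Y] normalises [Y :&: C] because [C] is normal, and [M2] does because it commutes with [C] modulo
   [M1]. *)
have nsBG: (Y :&: C)%G <| G.
  rewrite /normal subIset ?sYG //= -eYM2 mul_subG //.
    by rewrite normsI ?normG // (subset_trans sYG).
  rewrite -commg_subl (subset_trans _ sM1B) // (subset_trans _ cCM2) //.
  exact: commSg.
have [sBG nBG] := andP nsBG.
have eYC: Y * C = G.
  have eJ: Y <*> C = Y * C by rewrite norm_joinEl // (subset_trans sYG).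
  case/maxgroupP: maxY => _ maxY.
  apply: contraNeq nCY; rewrite -eJ => neG.
  have sJG: Y <*> C \subset G by rewrite join_subG sYG.
  rewrite -(maxY (Y <*> C)%G) ?joing_subl ?joing_subr //.
  by rewrite properEneq neG.
have nsYM2: Y :&: M2 <| M2.
  rewrite /normal subsetIr /=.
  apply: subset_trans sM2G _; rewrite -eYC mul_subG //.
    by rewrite normsI ?normG // (subset_trans sYG).
  rewrite -commg_subr (subset_trans _ (_ : M1 \subset _)) ?subsetI ?sM1Y //.
  by rewrite (subset_trans _ cCM2) // commgS ?subsetIr.
have tiYM2: Y :&: M2 = M1.
  have nsM1M2 := normalS sM12 sM2G nsM1G.
  rewrite quotient_simple // in simW.
  have [_ maxM1] := maxgroupP simW.
  apply: (maxM1 (Y :&: M2)%G); last by rewrite subsetI sM1Y.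
  rewrite properEneq subsetIr normal_norm // !andbT.
  apply: contraTneq pYG => eYM; rewrite -eYM2 mulGSid ?properxx //.
  by rewrite -eYM subsetIl.
set B := (Y :&: C)%G in sBC sM1B nsBG sBG nBG *.
(* Inside [K = C M2], the subgroup [D] supplements both [C] and [B M2] and meets each in [B]. Hence
   [D / B] is isomorphic to [K / C], that is [M2 / M1], and to [K / (B M2)], that is [C / B]. *)
split=> //; set K := (C <*> M2)%G; set D := (K :&: Y)%G.
have eK: K = C * M2 :> {set gT} by rewrite /= norm_joinEr // (subset_trans sM2G).
have eBM2: B <*> M2 = B * M2 by rewrite norm_joinEl // (subset_trans sBG).
have sKG : K \subset G by rewrite join_subG sCG.
have eD : D = K :&: Y :> {set gT} by [].
have sDK : D \subset K := subsetIl _ _.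
have sDG := subset_trans sDK sKG.
have nBM2G: G \subset 'N(B <*> M2) by rewrite normsY.
have iso1: (D / B)%g \isog (M2 / M1)%g.
  have eDC: D :&: C = B.
    rewrite /= setIAC setIC; congr (_ :&: _).
    by apply/setIidPr; rewrite joing_subl.
  have eDKC: D * C = K.
    by rewrite /= group_modr ?joing_subl //= eYC; apply/setIidPl.
  have := second_isog (subset_trans sDG nCG); rewrite setIC eDC => iso.
  have {}iso: (D / B)%g \isog (M2 / C)%g.
    by rewrite -(quotientMidl C M2) -eK -eDKC quotientMidr.
  apply: isog_trans iso _; rewrite isog_sym.
  by have := second_isog (subset_trans sM2G nCG); rewrite setIC tiM2C.
have iso2: (D / B)%g \isog (C / B)%g.
  have eDB: D :&: (B <*> M2) = B.
    have sBK: B * M2 \subset K by rewrite eK mulSg.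
    rewrite eBM2 eD (setIC K) -setIA (setIidPr sBK) setIC -group_modl ?subsetIl //.
    by rewrite setIC tiYM2 mulGSid.
  have eCB: C :&: (B <*> M2) = B.
    by rewrite eBM2 setIC -group_modl // tiM2C mulGSid.
  have eDK: D * (B <*> M2) = K.
    have sBD: B \subset D by rewrite eD subsetI (subset_trans sBC) ?joing_subl ?subsetIl.
    by rewrite eBM2 mulgA (mulGSid sBD) eD group_modr ?joing_subr // eYM2; apply/setIidPl.
  have := second_isog (subset_trans sDG nBM2G); rewrite setIC eDB => iso.
  apply: isog_trans iso _.
  have := second_isog (subset_trans sCG nBM2G); rewrite setIC eCB => iso.
  rewrite isog_sym; apply: isog_trans iso _.
  have eCK: C * (B <*> M2) = K by rewrite eBM2 mulgA (mulGSid sBC) eK.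
  by rewrite /= -(quotientMidr (B <*> M2)%G C) eCK -eDK quotientMidr isog_refl.
by apply: isog_trans iso1; rewrite isog_sym.
Qed.

End GroupTheory.

(** * Quotients that are cyclic modulo p, and their pullbacks *)

Section CyclicModExtension.

Variable p : nat.
Implicit Types gT rT : finGroupType.

(** States that [X / K] is p-by-cyclic through a witness [Q] among the subgroups of [X]; unlike the
    p-core of a quotient, such a witness is easily pulled back or enlarged. *)
Definition cyclic_mod_ext gT (X K : {group gT}) :=
  K <| X /\ exists Q : {group gT},
    [/\ Q <| X, K \subset Q, p.-group (Q / K) & cyclic (X / Q)].

Lemma cyclic_mod_quotient gT (X K : {group gT}) :
  K <| X -> cyclic_mod p (X / K) -> cyclic_mod_ext X K.
Proof.
move=> nsKX cycXK; split=> //; set O := 'O_p(X / K)%G.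
have sOX : coset K @*^-1 O <| X.
  by rewrite -(quotientGK nsKX) cosetpre_normal pcore_normal.
exists (coset K @*^-1 O)%G; split=> //.
- exact: sub_cosetpre.
- by rewrite /= cosetpreK pcore_pgroup.
rewrite -(isog_cyclic (third_isog (sub_cosetpre O) nsKX sOX)).
by rewrite /= cosetpreK.
Qed.

Lemma quotient_preim_isog gT rT (D E : {group gT}) (f : {morphism D >-> rT})
    (Q : {group rT}) :
    E \subset D -> f @* E \subset 'N(Q) ->
  (E / (E :&: f @*^-1 Q))%g \isog (f @* E / Q)%g.
Proof.
move=> sED nQE.
have sE : E \subset f @*^-1 'N(Q) by rewrite -sub_morphim_pre.
have := first_isog_loc (coset Q \o f) sE.
by rewrite ker_comp ker_coset morphim_comp.
Qed.

(** The preimages of [K] and [Q] serve: the new quotients embed in [Q / K] and [X / Q], and both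
    conditions pass to subgroups. *)
Lemma cyclic_mod_ext_preim gT rT (D E : {group gT}) (f : {morphism D >-> rT})
    (X K : {group rT}) :
    E \subset D -> f @* E \subset X -> cyclic_mod_ext X K ->
  cyclic_mod_ext E (E :&: f @*^-1 K).
Proof.
move=> sED sEX [nsKX [Q [nsQX sKQ pQK cycXQ]]].
have [sQX nQX] := andP nsQX; have nKX := normal_norm nsKX.
have nQE := subset_trans sEX nQX.
have nsP (R : {group rT}) : R <| X -> E :&: f @*^-1 R <| E.
  case/andP=> _ nRX; rewrite /normal subsetIl normsI ?normG //.
  apply: subset_trans (morphpre_norm _ _).
  by rewrite -sub_morphim_pre // (subset_trans sEX).
split; first exact: nsP.
exists (E :&: f @*^-1 Q)%G; split => /=.
- exact: nsP.
- by rewrite setIS // morphpreS.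
- set F := (E :&: f @*^-1 Q)%G.
  have sFE : F \subset E := subsetIl _ _.
  have sFQ : f @* F \subset Q.
    by rewrite (sub_morphim_pre _ _ (subset_trans sFE sED)); apply: subsetIr.
  have eK : E :&: f @*^-1 K = F :&: f @*^-1 K.
    by rewrite /= -setIA; congr (_ :&: _); apply/esym/setIidPr/morphpreS.
  have nKF := subset_trans (subset_trans sFQ sQX) nKX.
  have iso := quotient_preim_isog (subset_trans sFE sED) nKF.
  by rewrite eK /= /pgroup (card_isog iso); apply: pgroupS (quotientS _ sFQ) pQK.
rewrite (isog_cyclic (quotient_preim_isog sED nQE)).
exact: cyclicS (quotientS _ sEX) cycXQ.
Qed.

(** With [Q <*> L] as witness, its index over [L] equals that of [Q :&: L] in [Q], which divides
    [#|Q : K|]. *)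
Lemma cyclic_mod_extS gT (X K L : {group gT}) :
    K \subset L -> L <| X -> cyclic_mod_ext X K -> cyclic_mod_ext X L.
Proof.
move=> sKL nsLX [nsKX [Q [nsQX sKQ pQK cycXQ]]]; split=> //.
have [sLX nLX] := andP nsLX; have [sQX nQX] := andP nsQX.
have nsQLX : Q <*> L <| X by apply: normalY.
exists (Q <*> L)%G; split=> //.
- exact: joing_subr.
- have nLQ := subset_trans sQX nLX.
  have nKQ := subset_trans sQX (normal_norm nsKX).
  rewrite quotientYidr // /pgroup card_quotient // -indexgI.
  rewrite /pgroup card_quotient // in pQK.
  by apply: pnat_dvd pQK; rewrite indexgS // subsetI sKQ.
rewrite -(isog_cyclic (third_isog (joing_subl _ _) nsQX nsQLX)).
exact: quotient_cyclic.
Qed.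

End CyclicModExtension.

(** * Inner automorphisms and the action of [G] on a chief factor *)

Lemma inner_aut_normal (gT : finGroupType) (S : {group gT}) :
  conj_aut S @* S <| Aut S.
Proof.
rewrite /normal Aut_conj_aut; apply/subsetP=> a Aa; rewrite inE.
apply/subsetP=> _ /imsetP[_ /morphimP[s Ns Ss ->] ->].
have Sas : a s \in S by rewrite Aut_closed.
suff ->: conj_aut S s ^ a = conj_aut S (a s).
  by apply/morphimP; exists (a s); rewrite ?(subsetP (normG S)).
have Ac t : t \in S -> conj_aut S t \in Aut S.
  move=> St; apply: (subsetP (Aut_conj_aut S S)).
  by apply/morphimP; exists t; rewrite ?(subsetP (normG S)).
apply: (@eq_Aut _ S); rewrite ?Ac ?groupJ ?Ac // => u Su.
have Sv : a^-1 u \in S by rewrite Aut_closed ?groupV.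
rewrite conjgE !permM !norm_conj_autE ?(subsetP (normG S)) //.
rewrite -!(autmE Aa) morphJ // autmE; congr (_ ^ _).
by rewrite /= autmE permKV.
Qed.

(** The property of [Out S] is pulled back along [G -> G / M1 -> Aut W -> Aut S]; the resulting
    kernel consists of elements acting on [W] as inner automorphisms, and these lie in
    [M2 <*> C]. *)
Lemma cyclic_mod_aut_factor (gT sT : finGroupType) (G M1 M2 : {group gT})
    (S : {group sT}) p :
    M1 <| G -> M2 <| G -> (M2 / M1)%g \isog S -> cyclic_mod p (Out S) ->
  let C := (G :&: coset M1 @*^-1 'C(M2 / M1))%G in
  C <| G -> cyclic_mod_ext p G (M2 <*> C).
Proof.
move=> nsM1G nsM2G isoS cycOut C nsCG.
have [sM1G nM1G] := andP nsM1G; have [sM2G nM2G] := andP nsM2G.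
have [f injf imf] := isogP isoS; set W := (M2 / M1)%G in f injf imf *.
have nW : G / M1 \subset 'N(W) by rewrite quotient_norms.
have eS : Aut S = Aut (f @* W) by rewrite imf.
have c1 := cyclic_mod_quotient (inner_aut_normal S) cycOut.
pose h := Aut_isom_morphism injf (subxx W).
have sh : h @* Aut W \subset Aut S by rewrite im_Aut_isom eS.
have c2 := cyclic_mod_ext_preim (subxx (Aut W)) sh c1.
have s3 : conj_aut W @* (G / M1) \subset Aut W by apply: Aut_conj_aut.
have c3 := cyclic_mod_ext_preim nW s3 c2.
have c4 := cyclic_mod_ext_preim nM1G (subxx (G / M1)%g) c3.
(* If [x] acts on [W] as the image [w] of some [m] in [M2], then [m^-1 * x] centralises [W] and so
   belongs to [C]. *)
apply: cyclic_mod_extS c4; last exact: normalY.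
apply/subsetP=> x /setIP[Gx /morphpreP[Nx /setIP[_ /morphpreP[Wx]]]].
case/setIP=> Ax /morphpreP[_ /morphimP[s _ Ss ehs]].
have: s \in f @* W by rewrite imf.
case/morphimP=> w _ Ww es; have /morphimP[m Nm M2m ew] := Ww.
have Gm := subsetP sM2G m M2m.
suff Cxm : m^-1 * x \in C.
  by rewrite -(mulKVg m x) groupM // mem_gen // in_setU ?M2m ?Cxm ?orbT.
have xw u : u \in W -> u ^ coset M1 x = u ^ w.
  move=> Wu; have Wux : u ^ coset M1 x \in W by rewrite memJ_norm.
  apply: (injmP injf) => //; first by rewrite groupJ.
  have -> : f (u ^ w) = f u ^ s by rewrite morphJ // es.
  have := congr1 (fun c : {perm sT} => c (f u)) ehs => /=.
  rewrite Aut_isomE // norm_conj_autE // => ->.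
  by rewrite norm_conj_autE ?(subsetP (normG S)) // -imf mem_morphim.
have Nmx : m^-1 * x \in 'N(M1) by rewrite groupM ?groupV.
rewrite inE groupM ?groupV //=; apply/morphpreP; split=> //.
rewrite morphM ?groupV // morphV // -ew.
apply/centP=> u Wu; apply: commute_sym; apply/commgP/conjg_fixP.
by rewrite conjgM xw ?groupJ ?groupV // conjgKV.
Qed.

(** A p-group extended by a cyclic group is solvable, so it cannot cover the nonsolvable [G / C];
    this is the properness that [bsum_cyclic_mod_eq0] requires. *)
Lemma cyclic_mod_ext_bsum_eq0 (p : nat) (gT : finGroupType)
    (G C K : {group gT}) :
    C <| G -> ~~ solvable (G / C) -> cyclic_mod_ext p G K ->
  bsum G C K = 0%R.
Proof.
move=> nsCG nsol [nsKG [P [nsPG sKP pPK /cyclicP[x eGP]]]].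
have : x \in G / P by rewrite eGP cycle_id.
case/morphimP=> g Ng Gg ex; rewrite ex in eGP.
apply: (bsum_cyclic_mod_eq0 nsKG nsPG sKP pPK Gg eGP) => R y sRG pR.
case/setIP=> Gy Ny; set L := (R <*> <[y]>)%G.
have sLG : L \subset G by rewrite join_subG sRG cycle_subG.
have nyR : <[y]> \subset 'N(R) by rewrite cycle_subG.
have nsRL : R <| L by rewrite /normal joing_subl join_subG normG.
have solL : solvable L.
  rewrite (series_sol nsRL) (nilpotent_sol (pgroup_nil pR)) /=.
  by rewrite quotientYidl // abelian_sol // quotient_abelian // cycle_abelian.
rewrite properEneq join_subG (normal_sub nsCG) sLG !andbT.
apply: contraNneq nsol => <-.
by rewrite quotientYidl ?quotient_sol // (subset_trans sLG) ?normal_norm.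
Qed.

Theorem theorem4p1 (gT sT : finGroupType) (G : {group gT}) (S : {group sT}) (p : nat) :
  prime p ->
  simple S -> ~~ abelian S ->
  cyclic_mod p (Out S) ->
  (exists s : seq {group gT}, comps G s /\ comp_factor_count S G s = 1%N) ->
  forall N : {group gT}, beta_kernel G N -> ~~ solvable (G / N).
Proof.
move=> _ simS nabS cycOut [s [cGs cs1]] N [nsNG mN _].
apply: contra mN => solGN.
have nsolS := simple_nonabelian_nsol simS nabS.
have [M1 [M2 [nsM1G nsM2G sM12 sM2N isoS]]] :
  exists M1 M2 : {group gT},
    [/\ M1 <| G, M2 <| G, M1 \subset M2, M2 \subset N & (M2 / M1)%g \isog S].
  (* As [G / N] is solvable, no factor above [N] is isomorphic to [S]; the single copy occurs in
     [N]. *)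
  have [t ct et] := comp_path_exists nsNG; have [u cu] := exists_comps N.
  apply: (exists_chief_factor nsNG cu).
  move: cs1; rewrite (comp_factor_count_uniq S cGs (comps_path ct et cu)).
  by rewrite comp_factor_count_cat et (solvable_comp_factor_count nsolS nsNG solGN).
have simW : simple (M2 / M1) by rewrite (isog_simple isoS).
have nabW : ~~ abelian (M2 / M1) by rewrite (isog_abelian isoS).
have [] := cent_simple_factor nsM1G nsM2G sM12 simW nabW.
set C := (_ :&: _)%G => nsCG sM1C cCM2 tiM2C.
have [sM2G nM2G] := andP nsM2G; have [sCG nCG] := andP nsCG.
have isoM2C : (M2 / C)%g \isog S.
  have := second_isog (subset_trans sM2G nCG); rewrite setIC tiM2C => iso.
  by apply: isog_trans isoS; rewrite isog_sym.
have bC0 : bsum G C M2 = 0%R.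
  (* Every [X] in the sum absorbs [C], so supplementing [M2] and supplementing [M2 <*> C] are the
     same condition. *)
  have -> : bsum G C M2 = bsum G C (M2 <*> C).
    apply: eq_bigl => X; have [sCX|//] := boolP (C \subset X).
    have -> : X * (M2 <*> C) = X * M2; last by [].
    by rewrite joingC norm_joinEr ?(subset_trans sM2G) // mulgA (mulGSid sCX).
  apply: (@cyclic_mod_ext_bsum_eq0 p _ G C (M2 <*> C)) => //.
    apply: contra nsolS => solGC; rewrite -(isog_sol isoM2C).
    exact: solvableS (quotientS _ sM2G) solGC.
  exact: (cyclic_mod_aut_factor nsM1G nsM2G isoS cycOut nsCG).
have b12 : bsum G M1 M2 = 0%R.
  rewrite -{}bC0; apply: bsum_supplement => // Y maxY sM1Y eYM2.
  apply: contraT => nCY.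
  have [nsBG isoCB] := maximal_supplement_factor nsM1G nsM2G sM12 simW nsCG
    sM1C cCM2 tiM2C maxY sM1Y eYM2 nCY.
  have nsKG : M2 <*> C <| G by apply: normalY.
  (* [M2 <*> C] over [C] and [C] over [Y :&: C] would be two factors isomorphic to [S]. *)
  have lt1 : 1 < comp_factor_count S G s.
    apply: (two_comp_factors simS cGs nsKG (B := C) (C := C) (D := (Y :&: C)%G)).
    - exact: normalS (joing_subr _ _) (normal_sub nsKG) nsCG.
    - exact: normal_refl.
    - exact: normalS (subsetIr _ _) sCG nsBG.
    - by rewrite quotientYidr // (subset_trans sM2G).
    exact: isog_trans isoCB isoS.
  by rewrite cs1 in lt1.
have cG0 : (#|G|%:R != 0 :> rat)%R by rewrite pnatr_eq0 -lt0n.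
(* Multiplicativity along [M1], [M2], [N], and then along 1, [M1], [N], carries the zero down to the
   trivial subgroup. *)
have b1N : bsum G M1 N = 0%R.
  by apply/(mulIf cG0); rewrite (bsumM sM12 nsM2G sM2N) b12 !mul0r.
have bN : bsum G 1%G N = 0%R.
  apply/(mulIf cG0); rewrite (bsumM (sub1G M1) nsM1G (subset_trans sM12 sM2N)).
  by rewrite b1N mulr0 mul0r.
have -> : mGN G N = (bsum G 1%G N / #|G|%:R)%R; last by rewrite bN mul0r.
by congr (_ / _)%R; apply: eq_bigl => X; rewrite sub1G.
Qed.
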